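(* Assume the Continuum Hypothesis. Then there exists a compact, separable Hausdorff space which is van der Waerden but not Hindman.
   Context: $\omega=\{0,1,2,\dots\}$. A set $A\subseteq\omega$ is an AP-set if it contains arithmetic progressions of every finite length. For $B\subseteq\omega$, $FS(B)$ denotes the set of all sums $\sum_{n\in F}n$ over nonempty finite subsets $F\subseteq B$. A Hausdorff space $X$ is van der Waerden if for every sequence $(x_n)_{n\in\omega}$ in $X$ there is an AP-set $A\subseteq\omega$ such that the subsequence $(x_n)_{n\in A}$ converges. A sequence $(x_n)_{n\in FS(B)}$ ($B\subseteq\omega$ infinite) IP-converges to $x$ if for every neighborhood $U$ of $x$ there is $n_0$ with $\{x_n:n\in FS(B\setminus\{0,\dots,n_0-1\})\}\subseteq U$. A Hausdorff space $X$ is Hindman if for every sequence $(x_n)_{n\in\omega}$ in $X$ there is an infinite $B\subseteq\omega$ such that $(x_n)_{n\in FS(B)}$ IP-converges to some point of $X$. *)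

(* Defs.v *)
From HB Require Import structures.
From mathcomp Require Import all_boot all_order all_algebra.
From mathcomp Require Import all_classical all_reals topology.
Set Implicit Arguments. Unset Strict Implicit. Unset Printing Implicit Defensive.
Local Open Scope classical_set_scope.

Definition CH : Prop :=
  forall A : set (set nat), countable A \/ (A #= [set: set nat])%card.

Definition separable_space (T : topologicalType) : Prop :=
  exists D : set T, countable D /\ closure D = [set: T].

Definition AP_set (A : set nat) : Prop :=
  forall k : nat, exists a d : nat, (0 < d)%N /\
    forall i : nat, (i < k)%N -> A (a + i * d)%N.

Definition conv_along {T : topologicalType} (x : nat -> T) (A : set nat) (p : T) : Prop :=
  forall U : set T, nbhs p U ->
    exists N : nat, forall n : nat, A n -> (N <= n)%N -> U (x n).

Definition van_der_Waerden (T : topologicalType) : Prop :=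
  forall x : nat -> T, exists A : set nat, AP_set A /\ exists p : T, conv_along x A p.

Definition FS (B : set nat) : set nat :=
  [set n | exists s : seq nat,
     [/\ uniq s, s != [::], (forall i, i \in s -> B i) & n = \sum_(i <- s) i]].

Definition IP_converges {T : topologicalType} (x : nat -> T) (B : set nat) (p : T) : Prop :=
  forall U : set T, nbhs p U ->
    exists n0 : nat, forall n : nat, FS (B `\` [set m | (m < n0)%N]) n -> U (x n).

Definition Hindman (T : topologicalType) : Prop :=
  forall x : nat -> T, exists B : set nat, infinite_set B /\
    exists p : T, IP_converges x B p.

(* Main.v *)
(* Under CH, a transfinite recursion of length omega_1 over all pairs (C, f), with C an AP-set and
   f finite-to-one on C, builds an almost disjoint family AA of subsets of nat such that f sends
   some AP-subset of C into a member of AA, while no member of AA contains FS(B) with B infinite.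
   At each step the members built so far are countably many: either the preimage under f of one
   of them is an AP-set in C, or, AP-sets being partition regular by van der Waerden's theorem, C
   contains finite progressions, longer and longer, avoiding the preimages of more and more of
   those members and with images so sparse that the union of the images contains no FS(B).
   The space is the one-point compactification of the Mrowka-Isbell space of AA. A sequence is
   constant or finite-to-one on an AP-set, hence converges along one to a constant value, to the
   limit of a member of AA, or to infinity. The sequence of the isolated points themselves does
   not IP-converge along FS(B): not to the limit of a member of AA, which does not contain FS(B),
   and not to infinity, because some member of AA has infinite intersection with B. *)
Require Import Defs.
From HB Require Import structures.
From mathcomp Require Import all_boot all_classical topology.
From Stdlib Require Import Wellfounded.Inverse_Image.
From mathcomp Require Import zify.
Local Open Scope classical_set_scope.

(** * The finite van der Waerden theorem *)

(* Color focusing: either a monochromatic progression with k+1 terms, or [s] progressions with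
   k terms, monochromatic of distinct colors, that would all be continued by the same [a]. For
   [s] larger than the number of colors only the former is possible. *)
Lemma color_focusing (k : nat) (T : finType) : 0 < k ->
  (forall T' : finType, exists N, forall c : nat -> T', exists a d,
     [/\ 0 < d, a + k * d <= N & forall i, 0 < i <= k -> c (a + i * d) = c (a + d)]) ->
  forall s, exists M, forall c : nat -> T,
    (exists a d, [/\ 0 < d, a + k * d <= M & forall i, i <= k -> c (a + i * d) = c a])
    \/ (exists a (ds : seq nat), [/\ a <= M, size ds = s,
          uniq [seq c (a + d) | d <- ds] &
          forall d, d \in ds -> [/\ 0 < d, a + k * d <= M &
            forall i, 0 < i <= k -> c (a + i * d) = c (a + d)]]).
Proof.
move=> k_gt0 vdWk; elim=> [|s [M IHM]].
  by exists 0 => c; right; exists 0, [::]; split.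
(* The color of [n] is the coloring of the whole block of [M.+1] numbers from [n * M.+1] on, so [k]
   equally spaced blocks look alike. *)
have [N blockAP] := vdWk {ffun 'I_M.+1 -> T}.
exists (N * M.+1 + M) => c.
have [a' [d' [d'_gt0 a'N a'mono]]] :=
  blockAP (fun n => [ffun i : 'I_M.+1 => c (n * M.+1 + i)]).
have period i x : 0 < i <= k -> x <= M ->
    c ((a' + i * d') * M.+1 + x) = c ((a' + d') * M.+1 + x).
  move=> ik xM; have xM' : x < M.+1 by [].
  by have /ffunP/(_ (Ordinal xM')) := a'mono i ik; rewrite !ffunE.
have a'kN x : x <= M -> (a' + k * d') * M.+1 + x <= N * M.+1 + M.
  by move=> xM; apply: leq_add => //; rewrite leq_mul2r a'N orbT.
have mono_ext a d : 0 < d -> a + k * d <= M ->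
    (forall i, 0 < i <= k -> c ((a' + d') * M.+1 + (a + i * d)) =
                         c ((a' + d') * M.+1 + (a + d))) ->
    forall i, 0 < i <= k ->
      c (a' * M.+1 + a + i * (d' * M.+1 + d)) = c (a' * M.+1 + a + (d' * M.+1 + d)).
  move=> d0 aM H i /andP[i0 ik].
  have -> : a' * M.+1 + a + i * (d' * M.+1 + d) =
            (a' + i * d') * M.+1 + (a + i * d) by lia.
  rewrite period ?i0//; last by apply: leq_trans aM; rewrite leq_add2l leq_mul2r ik orbT.
  by rewrite H ?i0//; congr c; lia.
have [[a [d [d_gt0 aM amono]]]|[a [ds [aM sz_ds ds_uniq dsP]]]] :=
    IHM (fun n => c ((a' + d') * M.+1 + n)).
- left; exists ((a' + d') * M.+1 + a), d; split=> //.
    rewrite -addnA; apply: leq_trans (leq_add (leqnn _) aM) _.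
    by rewrite leq_add2r leq_mul2r (leq_trans _ a'N) ?orbT// leq_add2l leq_pmull.
  by move=> i ik; rewrite -addnA; apply: amono.
- have [cf|cf] := boolP (c ((a' + d') * M.+1 + a) \in
      [seq c ((a' + d') * M.+1 + (a + d)) | d <- ds]).
    have /mapP[d /dsP[d_gt0 adM dmono] cfE] := cf.
    left; exists ((a' + d') * M.+1 + a), d; split=> //.
      rewrite -addnA; apply: leq_trans (leq_add (leqnn _) adM) _.
      by rewrite leq_add2r leq_mul2r (leq_trans _ a'N) ?orbT// leq_add2l leq_pmull.
    by case=> [|i] ik; rewrite ?mul0n ?addn0// -addnA dmono.
  (* The new focus is the copy of [a] in block [a']. The old progressions now also advance by [d']
     blocks at each step; the copies of [a] in the later blocks form the additional one, of a new
     color by [cf]. *)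
  right; exists (a' * M.+1 + a), (d' * M.+1 :: [seq d' * M.+1 + d | d <- ds]).
  split.
  + by apply: leq_add => //; rewrite leq_mul2r (leq_trans (leq_addr _ _) a'N) orbT.
  + by rewrite /= size_map sz_ds.
  + rewrite /= -map_comp.
    rewrite (_ : a' * M.+1 + a + d' * M.+1 = (a' + d') * M.+1 + a); last by lia.
    rewrite (_ : map _ ds = [seq c ((a' + d') * M.+1 + (a + d)) | d <- ds]).
      by rewrite cf ds_uniq.
    by apply: eq_map => d /=; congr c; lia.
  + move=> d; rewrite inE => /predU1P[->|/mapP[e /dsP[e_gt0 aeM emono] ->]].
      split; first by lia.
        by have := a'kN _ aM; lia.
      move=> i ik; rewrite (_ : a' * _ + _ + _ = (a' + i * d') * M.+1 + a); last by lia.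
      by rewrite period//; congr c; lia.
    split; first by lia.
      by have := a'kN _ aeM; lia.
    exact: mono_ext.
Qed.

(** The term [a] is only a focus, and its color is left free. Induction on [k]: there cannot be more
    focused progressions than colors, so focusing must yield a longer monochromatic one. *)
Theorem van_der_Waerden_finite (k : nat) (T : finType) :
  exists N, forall c : nat -> T, exists a d,
    [/\ 0 < d, a + k * d <= N & forall i, 0 < i <= k -> c (a + i * d) = c (a + d)].
Proof.
case: k => [|k].
  exists 0 => c; exists 0, 1; split=> // i; lia.
elim: k => [|k IHk] in T *.
  exists 1 => c; exists 0, 1; split=> // i /andP[? ?].
  by have -> : i = 1 by lia.
have [//|M MP] := @color_focusing k.+1 T _ IHk #|T|.+1.
(* Coloring from [M] on leaves room for the term [M + a - d] before the progression, as [d <= M]. *)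
exists (M + M) => c.
have [[a [d [d_gt0 adM dmono]]]|[a [ds [_ sz_ds ds_uniq _]]]] :=
    MP (fun n => c (M + n)); last first.
  have := max_card [in [seq c (M + (a + d)) | d <- ds]].
  by rewrite (card_uniqP ds_uniq) size_map sz_ds ltnn.
exists (M + a - d), d; split=> //; first by nia.
case=> // i; rewrite ltnS => /andP[_ ik].
rewrite (_ : M + a - d + i.+1 * d = M + (a + i * d)); last by nia.
by rewrite (_ : M + a - d + d = M + a); [exact: dmono | nia].
Qed.

(** * Partition regularity of AP-sets and construction by blocks *)

Lemma AP_setS (A B : set nat) : A `<=` B -> AP_set A -> AP_set B.
Proof.
by move=> AB AP k; have [a [d [d0 H]]] := AP k; exists a, d; split=> // i /H /AB.
Qed.

Lemma AP_setT : AP_set setT.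
Proof. by move=> k; exists 0, 1. Qed.

Lemma AP_set_unbounded (A : set nat) : AP_set A -> forall N, exists2 n, N <= n & A n.
Proof.
move=> AP N; have [a [d [d0 H]]] := AP N.+1.
by exists (a + N * d); [nia | exact: H].
Qed.

Lemma AP_set0 : ~ AP_set set0.
Proof. by move=> /AP_set_unbounded/(_ 0)[]. Qed.

(** If the two parts failed at lengths [k1] and [k2], coloring the indices of a long progression in
    [A] by membership in [B] would contradict the finite theorem. *)
Lemma AP_set_split (A B : set nat) : AP_set A -> ~ AP_set (A `&` B) -> AP_set (A `\` B).
Proof.
move=> AP; have [//|nAP1] := pselect (AP_set (A `\` B)).
case; apply: contrapT => nAP2; move: nAP1 nAP2.
move=> /existsNP[k1 H1] /existsNP[k2 H2].
have [N NP] := van_der_Waerden_finite (maxn k1 k2) bool.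
have [a [d [d_gt0 adA]]] := AP N.+1.
have [b [e [e_gt0 beN emono]]] := NP (fun n => `[< B (a + n * d) >]).
have AE i : i < maxn k1 k2 -> A (a + (b + e) * d + i * (e * d)).
  move=> ik; rewrite (_ : _ + _ = a + (b + i.+1 * e) * d); last by lia.
  by apply: adA; nia.
have BE i : i < maxn k1 k2 ->
    `[< B (a + (b + e) * d + i * (e * d)) >] = `[< B (a + (b + e) * d) >].
  move=> ik; rewrite -(emono i.+1)// (_ : _ + _ = a + (b + i.+1 * e) * d)//; lia.
have [Bb|nBb] := pselect (B (a + (b + e) * d)).
  apply: H2; exists (a + (b + e) * d), (e * d); split=> [|i ik]; first by lia.
  have ik' : i < maxn k1 k2 by rewrite leq_max ik orbT.
  by split; [exact: AE|]; apply/asboolP; rewrite BE//; exact/asboolP.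
apply: H1; exists (a + (b + e) * d), (e * d); split=> [|i ik]; first by lia.
have ik' : i < maxn k1 k2 by rewrite leq_max ik.
by split; [exact: AE|]; apply/asboolPn; rewrite BE//; exact/asboolPn.
Qed.

Lemma AP_set_bigcup (I : eqType) (s : seq I) (F : I -> set nat) (A : set nat) :
  AP_set A -> (forall i, i \in s -> ~ AP_set (A `&` F i)) ->
  AP_set (A `\` \bigcup_(i in [set` s]) F i).
Proof.
elim: s A => [|i s IHs] A AP nAP.
  by apply: AP_setS AP => n An; split=> // -[].
have /IHs AP' : AP_set (A `\` F i) by apply: AP_set_split => //; apply: nAP; rewrite mem_head.
apply: AP_setS (AP' _).
  move=> n [[An nF] nFs]; split=> // -[j /=]; rewrite inE => /predU1P[->//|js Fj].
  by apply: nFs; exists j.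
move=> j js /AP_setS AP''; apply: (nAP j); first by rewrite inE js orbT.
by apply: AP'' => n [[]].
Qed.

(** Fusion: block [S k] is a [k]-term progression inside a set that may depend on all earlier
    blocks. *)
Lemma AP_set_blocks (Q : nat -> seq nat -> set nat) : (forall k s, AP_set (Q k s)) ->
  exists S : nat -> seq nat,
    AP_set [set n | exists k, n \in S k] /\
    forall k n, n \in S k -> Q k (flatten [seq S i | i <- iota 0 k]) n.
Proof.
move=> AP.
have /choice[b bP] (s : nat * seq nat) : exists t : seq nat,
    (exists a d, 0 < d /\ t = mkseq (fun i => a + i * d) s.1) /\
    (forall n, n \in t -> Q s.1 s.2 n).
  have [a [d [d0 H]]] := AP s.1 s.2 s.1.
  exists (mkseq (fun i => a + i * d) s.1); split; first by exists a, d.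
  by move=> n /mapP[i]; rewrite mem_iota => /H ? ->.
pose past := fix past k := if k is k'.+1 then past k' ++ b (k', past k') else [::].
pose S k := b (k, past k).
have pastE k : flatten [seq S i | i <- iota 0 k] = past k.
  by elim: k => // k IHk; rewrite -addn1 iotaD map_cat flatten_cat IHk /= cats0 addn1.
exists S; split=> [k|k n]; last by rewrite pastE => /(bP (k, past k)).2.
have [[a [d [d0 SE]]] _] := bP (k, past k).
exists a, d; split=> // i ik; exists k; rewrite /S SE.
by apply/mapP; exists i; rewrite ?mem_iota.
Qed.

(** * Finite-to-one maps and sparse images *)

Definition finite_to_one_on {X : Type} (x : nat -> X) (C : set nat) :=
  forall p, exists N, forall n, C n -> N <= n -> x n <> p.

(** If no fiber is an AP-set in [A], removing finitely many fibers leaves an AP-set, so each block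
    can avoid the values on the earlier ones; a value then occurs in at most one block. *)
Lemma AP_constant_or_finite_to_one (X : Type) (x : nat -> X) (A : set nat) :
  AP_set A ->
  (exists p, AP_set (A `&` [set n | x n = p])) \/
  (exists2 C, AP_set C & C `<=` A /\ finite_to_one_on x C).
Proof.
move=> AP; have [|nconst] := pselect (exists p, AP_set (A `&` [set n | x n = p])).
  by left.
right.
pose Q (k : nat) (s : seq nat) := A `\` \bigcup_(m in [set` s]) [set n | x n = x m].
have [k s|S [APS SQ]] := @AP_set_blocks Q.
  by apply: AP_set_bigcup => // m _ AP'; apply: nconst; exists (x m).
exists [set n | exists k, n \in S k] => //; split=> [n [k /SQ[]]//|p].
have [[k [m mS xm]]|nS] := pselect (exists k, exists2 m, m \in S k & x m = p); last first.
  by exists 0 => n [k nSk] _ xn; apply: nS; exists k, n.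
pose L := \max_(i <- flatten [seq S j | j <- iota 0 k.+1]) i.
exists L.+1 => n [l nSl] Ln xn.
have [lk|kl] := leqP l k.
  suff : n <= L by lia.
  apply: (@leq_bigmax_seq _ _ xpredT id) => //.
  by apply/flattenP; exists (S l); rewrite // map_f// mem_iota.
have [_] := SQ _ _ nSl; apply; exists m => /=; last by rewrite xn.
by apply/flattenP; exists (S k) => //; rewrite map_f// mem_iota.
Qed.

Lemma finite_to_one_onS (X : Type) (x : nat -> X) (C D : set nat) :
  D `<=` C -> finite_to_one_on x C -> finite_to_one_on x D.
Proof. by move=> DC f1 p; have [N NP] := f1 p; exists N => n /DC; exact: NP. Qed.

Lemma finite_to_one_on_avoid (X : Type) (x : nat -> X) (C : set nat) (P : set X) :
  finite_to_one_on x C -> finite_set P ->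
  exists N, forall n, C n -> N <= n -> ~ P (x n).
Proof.
elim/Pchoice: X => X in x P *; move=> f1 /finite_seqP[s ->].
elim: s => [|p s [N NP]]; first by exists 0.
have [M MP] := f1 p; exists (maxn M N) => n Cn; rewrite geq_max => /andP[Mn Nn] /=.
by rewrite inE => /predU1P[|]; [exact: MP | exact: NP].
Qed.

(** Stronger than containing no [FS B] with [B] infinite: already a sum of two distinct elements is
    missing. *)
Definition contains_no_pair_sums (S : set nat) := forall B : set nat,
  infinite_set B -> B `<=` S -> exists b b', [/\ B b, B b', b < b' & ~ S (b + b')].

(* Within a block the values of [f] are congruent modulo a number larger than all values on the
   previous blocks, and they exceed twice those values: hence [b + b'], with [b] in an earlier
   block than [b'], is too small for the later blocks, and not congruent to [b']. *)
Lemma AP_set_sparse_image (f : nat -> nat) (C : set nat) (PP : set (set nat)) :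
  countable PP -> AP_set C -> finite_to_one_on f C ->
  (forall B, PP B -> ~ AP_set (C `&` f @^-1` B)) ->
  exists D, [/\ AP_set D, D `<=` C, contains_no_pair_sums (f @` D) &
    forall B, PP B -> finite_set (B `&` f @` D)].
Proof.
move=> /countable_injP[g g_inj] AP f1 nAP.
(* The member of [PP] with code [i], or the empty set if there is none; the values of [f] on block
   [k] will avoid [P i] for [i < k]. *)
pose P i := [set m | exists B, [/\ PP B, g B = i & B m]].
have nAPP i : ~ AP_set (C `&` f @^-1` P i).
  have [[B PB gB]|nP] := pselect (exists2 B, PP B & g B = i).
    apply: contra_not (nAP _ PB); apply: AP_setS => n [Cn [B' [PB' gB' B'n]]]; split=> //=.
    by rewrite (g_inj B B') ?inE// gB'.
  by move=> /AP_set_unbounded/(_ 0)[n _ [_ [B [PB gB _]]]]; apply: nP; exists B.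
pose mx s := \max_(n <- s) f n.
have mxP s n : n \in s -> f n <= mx s.
  by move=> ns; apply: (@leq_bigmax_seq _ _ xpredT f).
have /choice[Q0 Q0P] (ks : nat * seq nat) : exists Q : set nat, AP_set Q /\
    exists r, forall n, Q n -> [/\ C n, forall i, i < ks.1 -> ~ P i (f n),
      2 * mx ks.2 < f n & f n %% (mx ks.2).+1 = r].
  case: ks => k s /=; pose m := (mx s).+1.
  pose A := (C `\` \bigcup_(i in [set` iota 0 k]) f @^-1` P i) `\` [set n | f n <= 2 * mx s].
  have APA : AP_set A.
    apply: AP_set_split; first exact: AP_set_bigcup.
    move=> /AP_set_unbounded AP'.
    have [N NP] := finite_to_one_on_avoid _ _ _ _ f1 (finite_II (2 * mx s).+1).
    have [n Nn [[Cn _] /= fn]] := AP' N.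
    by apply: (NP n Cn Nn) => /=; rewrite ltnS.
  have [r APr] : exists r, AP_set (A `&` [set n | f n %% m = r]).
    apply: contrapT => /forallNP nr.
    have /AP_set_unbounded/(_ 0)[n _ [_]] :
        AP_set (A `\` \bigcup_(r in [set` iota 0 m]) [set n | f n %% m = r]).
      by apply: AP_set_bigcup => // r _; apply: nr.
    have fm : f n %% m \in iota 0 m by rewrite mem_iota ltn_mod.
    by apply; exists (f n %% m).
  exists (A `&` [set n | f n %% m = r]); split=> //; exists r => n [[[Cn nP] /= fn] fr].
  split=> //; last by lia.
  by move=> i ik Pi; apply: nP; exists i; rewrite //= mem_iota.
have [k s|S [APS SQ]] := @AP_set_blocks (fun k s => Q0 (k, s)).
  exact: (Q0P (k, s)).1.
set D := [set n | _] in APS.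
pose past k := flatten [seq S i | i <- iota 0 k].
have past_lt j k n : j < k -> n \in S j -> n \in past k.
  by move=> jk nS; apply/flattenP; exists (S j); rewrite // map_f// mem_iota.
have blockP k n : n \in S k -> [/\ C n, forall i, i < k -> ~ P i (f n) & 2 * mx (past k) < f n].
  by move=> /SQ nQ; have [_ [r /(_ _ nQ)[]]] := Q0P (k, past k).
have blockmod k n n' : n \in S k -> n' \in S k -> f n = f n' %[mod (mx (past k)).+1].
  by move=> /SQ nQ /SQ n'Q; have [_ [r rP]] := Q0P (k, past k);
    have [_ _ _ ->] := rP _ nQ; have [_ _ _ ->] := rP _ n'Q.
have finpast k : finite_set [set` [seq f n | n <- past k]] by exact: finite_seq.
exists D; split=> //.
- by move=> n [k /blockP[]].
- move=> B Binf BD.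
  (* [b] must be nonzero: were [b + b'] a value on the block of [b'], then [b] would vanish modulo a
     number exceeding it. *)
  have /infinite_setN0[b [Bb /eqP b0]] : infinite_set (B `\ 0).
    by apply: infinite_setD => //; exact: finite_set1.
  have [n [j nSj] fn] := BD b Bb.
  have /infinite_setN0[b' [Bb' /negP b'past]] :
      infinite_set (B `\` [set` [seq f n | n <- past j.+1]]).
    exact: infinite_setD.
  have [n' [k n'Sk] fn'] := BD b' Bb'.
  have jk : j < k.
    rewrite ltnNge; apply/negP => kj; move/negP: b'past; apply.
    by rewrite -fn'; apply: map_f; exact: (past_lt k).
  have nk := mxP _ _ (past_lt _ _ _ jk nSj).
  have [_ _ b'gt] := blockP _ _ n'Sk.
  exists b, b'; split=> //; first by lia.
  move=> [n'' [l n''Sl] fn''].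
  have [lk|kl|lk] := ltngtP l k.
  + by have := mxP _ _ (past_lt _ _ _ lk n''Sl); lia.
  + by have := mxP _ _ (past_lt _ _ _ kl n'Sk); have [_ _] := blockP _ _ n''Sl; lia.
  + subst l; have /eqP := blockmod k _ _ n''Sl n'Sk.
    rewrite fn'' fn' -[X in _ == X %[mod _]]add0n eqn_modDr mod0n modn_small ?ltnS; lia.
- move=> B PB; apply: sub_finite_set (finpast (g B).+1) => _ [/[swap] -[n [k nSk] <-] Bfn] /=.
  apply: map_f; have [kB|Bk] := leqP k (g B); first exact: (past_lt k).
  by have [_ /(_ _ Bk)[]] := blockP _ _ nSk; exists B.
Qed.

(** * The almost disjoint family under CH *)

(* In a well-order of [set nat], either all initial segments are countable or, by CH, the least
   uncountable one is equipotent to [set nat]. *)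
Lemma CH_well_founded_order : CH -> exists R : set nat -> set nat -> Prop,
  [/\ well_founded R, forall X Y, X <> Y -> R X Y \/ R Y X &
      forall X, countable [set Y | R Y X]].
Proof.
move=> ch; have [R0 wo] := wochoice.well_ordering_principle (set nat).
have woT : wochoice.wo_chain R0 predT by move=> A _; exact: wo.
have tot X Y : R0 X Y || R0 Y X by exact: (wochoice.wo_chainW woT).
have anti X Y : R0 X Y -> R0 Y X -> X = Y.
  by move=> XY YX; apply: (wochoice.wo_chain_antisymmetric woT) => //; rewrite XY.
have minP (A : set (set nat)) : A !=set0 ->
    exists2 X, A X & forall Y, A Y -> R0 X Y.
  move=> [X AX]; have [|Z [[/asboolP AZ minZ] _]] := wo [pred X | `[< A X >]].
    by exists X; apply/asboolP.
  by exists Z => // Y AY; apply: minZ; apply/asboolP.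
pose S X Y := R0 X Y /\ X <> Y.
have Swf : well_founded S.
  apply: contrapT => /existsNP[X nX].
  have [|Z nZ minZ] := minP [set X | ~ Acc S X]; first by exists X.
  apply: nZ; constructor => Y [YZ neYZ]; apply: contrapT => /minZ ZY.
  exact/neYZ/anti.
have Stot X Y : X <> Y -> S X Y \/ S Y X.
  by move=> XY; have /orP[] := tot X Y; [left|right]; split=> // /esym.
have [Sc|nSc] := pselect (forall X, countable [set Y | S Y X]); first by exists S.
have [|X0 X0nc X0min] := minP [set X | ~ countable [set Y | S Y X]].
  by move/existsNP : nSc.
have [//|] := ch [set Y | S Y X0].
rewrite card_eq_sym => /pcard_eqP[k].
have k_inj X Y : k X = k Y -> X = Y by move=> /(inj (f := k)); apply; rewrite inE.
exists (fun X Y => S (k X) (k Y)); split.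
- exact: wf_inverse_image Swf.
- by move=> X Y XY; apply: Stot => /k_inj.
- move=> X; have [kX neX] : S (k X) X0 by exact: (@funS _ _ _ _ k X).
  have /countable_injP[g g_inj] : countable [set Y | S Y (k X)].
    by apply: contrapT => /X0min ?; apply/neX/anti.
  apply/countable_injP; exists (g \o k) => Y Z; rewrite !inE => SY SZ /g_inj.
  by rewrite !inE => /(_ SY SZ)/k_inj.
Qed.

Lemma transfinite_recursion (T U : Type) (R : T -> T -> Prop) (F : T -> set U -> U) :
  well_founded R -> exists G : T -> U, forall x, G x = F x (G @` [set y | R y x]).
Proof.
move=> Rwf.
pose step x (rec : forall y, R y x -> U) := F x [set u | exists y (yx : R y x), rec y yx = u].
exists (Fix Rwf (fun=> U) step) => x; rewrite Fix_eq; last first.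
  move=> {}x f g fg; congr step; apply: functional_extensionality_dep => y.
  by apply: functional_extensionality_dep => yx.
congr F; apply/seteqP; split=> u; first by move=> [y [yx <-]]; exists y.
by move=> [y yx <-]; exists y, yx.
Qed.

Lemma CH_AP_almost_disjoint_family : CH -> exists AA : set (set nat),
  [/\ forall A, AA A -> infinite_set A /\ contains_no_pair_sums A,
      forall A B, AA A -> AA B -> A <> B -> finite_set (A `&` B) &
      forall (C : set nat) (f : nat -> nat), AP_set C -> finite_to_one_on f C ->
        exists2 A, AA A & exists2 D, AP_set D & D `<=` C `&` f @^-1` A].
Proof.
move=> /CH_well_founded_order[R [Rwf Rtot Rc]].
pose dom (X : set nat) := [set n : nat | exists m : nat, X (choice.pickle (n, m))].
pose val (X : set nat) (n : nat) := xget 0 [set m : nat | X (choice.pickle (n, m))].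
pose good X PP S := [/\ infinite_set S, contains_no_pair_sums S,
  forall B, PP B -> finite_set (B `&` S) &
  exists2 D, AP_set D & D `<=` dom X `&` val X @^-1` S].
(* The default [set0] marks a stage that adds no member; it is excluded from the family below. *)
have [G GE] := @transfinite_recursion _ _ R (fun X PP => xget set0 (good X PP)) Rwf.
have G0good X : G X = set0 \/ good X (G @` [set Y | R Y X]) (G X).
  by rewrite GE; case: xgetP => [S _ SP|_]; [right|left].
exists [set A | A <> set0 /\ exists X, G X = A]; split.
- by move=> A [A0 [X GX]]; have [|] := G0good X; rewrite GX// => -[].
- have ad X Y : R X Y -> finite_set (G X `&` G Y).
    move=> XY; have [->|[_ _ fin _]] := G0good Y; first by rewrite setI0; exact: finite_set0.
    by apply: fin; exists X.
  move=> _ _ [_ [X <-]] [_ [Y <-]] XY.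
  have [|/ad//|/ad] := Rtot X Y; first by move=> E; apply: XY; rewrite E.
  by rewrite setIC.
- move=> C f AP f1.
  (* [X] codes the graph of [f] on [C]; [dom] and [val] decode it. *)
  pose X : set nat := [set k | exists n : nat, C n /\ choice.pickle (n, f n) = k].
  have XE n m : X (choice.pickle (n, m)) <-> C n /\ m = f n.
    split=> [[n' [Cn' /(pcan_inj choice.pickleK)[<- <-]]]//|[Cn ->]].
    by exists n.
  have domX : dom X = C.
    apply/seteqP; split=> n; first by move=> [m /XE[]].
    by move=> Cn; exists (f n); apply/XE.
  have valX n : C n -> val X n = f n.
    move=> Cn; have /XE[] // : X (choice.pickle (n, val X n)).
    by apply: (xgetI 0 (P := [set m | X (choice.pickle (n, m))]) (x := f n)); apply/XE.
  pose PP := G @` [set Y | R Y X].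
  have [[B [Y RYX GY] APB]|nAP] :=
      pselect (exists2 B, PP B & AP_set (C `&` f @^-1` B)).
    exists B; last by exists (C `&` f @^-1` B).
    split; last by exists Y.
    by move=> B0; move: APB; rewrite B0 preimage_set0 setI0; exact: AP_set0.
  have [||D [APD DC Dsums Dfin]] := @AP_set_sparse_image f C PP _ AP f1.
  + by apply: sub_countable (Rc X); exact: card_image_le.
  + by move=> B PB APB; apply: nAP; exists B.
  (* The image of [D] under [f] only shows that a good set exists; [G X] may be another one, with
     its own AP-set [E]. *)
  have [GX0|[Ginf _ _ [E APE EP]]] := G0good X.
    suff : good X PP (G X).
      by move=> [inf _ _ _]; exfalso; apply: inf; rewrite GX0; exact: finite_set0.
    rewrite GE; apply: (xgetI set0 (x := f @` D)); split=> //.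
      move=> /finite_seqP[s sE].
      have f1D : finite_to_one_on f D by exact: finite_to_one_onS _ _ _ _ DC f1.
      have [N NP] := finite_to_one_on_avoid _ _ _ _ f1D (finite_seq s).
      have [n Nn Dn] := AP_set_unbounded _ APD N.
      by apply: (NP n Dn Nn); rewrite -sE; exists n.
    exists D => // n Dn; split; first by rewrite domX; exact: DC.
    by rewrite /= valX; [exists n | exact: DC].
  exists (G X).
    by split; [move=> GX0; apply: Ginf; rewrite GX0; exact: finite_set0 | exists X].
  exists E => // n /EP[]; rewrite domX => Cn /=.
  by rewrite valX.
Qed.

(** * The compactified Mrowka-Isbell space *)

Inductive psi_compactification (AA : set (set nat)) : Type :=
| Isol of nat
| Lim (A : set nat) of AA A
| Infty.
Arguments Isol {AA}.
Arguments Lim {AA}.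
Arguments Infty {AA}.

HB.instance Definition _ AA := gen_eqMixin (psi_compactification AA).
HB.instance Definition _ AA := gen_choiceMixin (psi_compactification AA).

(* The neighborhoods of [Infty] omit finitely many cones (see [cone]) and finitely many isolated
   points. *)
Definition psi_near {AA} (p : psi_compactification AA) (U : set (psi_compactification AA)) :=
  match p with
  | Isol _ => True
  | Lim A _ => finite_set (A `\` Isol @^-1` U)
  | Infty => exists2 s : seq (set nat),
      (forall A (AAA : AA A), A \notin s -> U (Lim A AAA)) &
      finite_set [set n | ~ U (Isol n) /\ forall A, AA A -> A \in s -> ~ A n]
  end.

Definition psi_open {AA} (U : set (psi_compactification AA)) := forall p, U p -> psi_near p U.

Lemma psi_near_subset {AA} (p : psi_compactification AA) U V :
  U `<=` V -> psi_near p U -> psi_near p V.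
Proof.
move=> UV; case: p => [//|A AAA|] /=.
  by apply: sub_finite_set => n [An nV]; split=> // /UV.
move=> [s sU fin]; exists s; first by move=> A AAA /sU /UV.
by apply: sub_finite_set fin => n [nV ns]; split=> // /UV.
Qed.

Lemma psi_openT AA : psi_open [set: psi_compactification AA].
Proof.
move=> [//|A AAA _|_] /=; first by rewrite preimage_setT setDT; exact: finite_set0.
by exists [::] => //; apply: sub_finite_set (@finite_set0 nat) => n [].
Qed.

Lemma psi_openI AA : setI_closed (@psi_open AA).
Proof.
move=> U V oU oV p [/oU + /oV]; case: p => [//|A AAA|] /=.
  rewrite preimage_setI setDIr => finU finV; rewrite finite_setU; split; [exact: finU|exact: finV].
move=> [s sU finU] [t tV finV]; exists (s ++ t).
  by move=> A AAA; rewrite mem_cat negb_or => /andP[/sU ? /tV].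
have : finite_set ([set n | ~ U (Isol n) /\ forall A, AA A -> A \in s -> ~ A n] `|`
                   [set n | ~ V (Isol n) /\ forall A, AA A -> A \in t -> ~ A n]).
  by rewrite finite_setU.
move=> fin; apply: sub_finite_set fin => n [/not_andP[nU|nV] nst].
  by left; split=> // A AAA As; apply: nst; rewrite // mem_cat As.
by right; split=> // A AAA As; apply: nst; rewrite // mem_cat As orbT.
Qed.

Lemma psi_open_bigU AA (I : Type) (f : I -> set (psi_compactification AA)) :
  (forall i, psi_open (f i)) -> psi_open (\bigcup_i f i).
Proof.
by move=> fo p [i _ /fo]; apply: psi_near_subset; exact: bigcup_sup.
Qed.

HB.instance Definition _ AA := @isOpenTopological.Build (psi_compactification AA)
  (@psi_open AA) (psi_openT AA) (@psi_openI AA) (psi_open_bigU AA).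

Lemma psi_openE AA (U : set (psi_compactification AA)) : open U = psi_open U.
Proof. by []. Qed.

Lemma psi_nbhs {AA} (p : psi_compactification AA) U : nbhs p U -> U p /\ psi_near p U.
Proof.
rewrite nbhsE => -[O [oO Op] OU]; split; first exact: OU.
exact/(psi_near_subset _ _ _ OU)/oO.
Qed.

(** For [A] in [AA], a basic neighborhood of its limit point; clopen once [AA] is almost
    disjoint. *)
Definition cone {AA} (A : set nat) : set (psi_compactification AA) :=
  fun p => match p with Isol n => A n | Lim B _ => B = A | Infty => False end.

Lemma open_cone AA (A : set nat) : open (@cone AA A).
Proof.
rewrite psi_openE => -[//|B AAB /= ->|//].
by apply: sub_finite_set (@finite_set0 nat) => n [].
Qed.

(** Almost disjointness keeps the other limit points out of the closure of the cone; for [Infty],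
    the cone is one of the finitely many that may be omitted. *)
Lemma open_coneC AA (A : set nat) : AA A ->
  (forall B, AA B -> B <> A -> finite_set (A `&` B)) -> open (~` @cone AA A).
Proof.
move=> AAA ad; rewrite psi_openE => -[//|B AAB /= BA|_].
  by apply: sub_finite_set (ad B AAB BA) => n [Bn /= /contrapT].
exists [:: A] => [B AAB /=|]; first by rewrite inE => /eqP.
apply: sub_finite_set (@finite_set0 nat) => n [/contrapT An /(_ A AAA)].
by rewrite inE => /(_ (eqxx _)).
Qed.

Lemma open_Isol AA (n : nat) : open [set @Isol AA n].
Proof. by rewrite psi_openE => p ->. Qed.

Lemma open_IsolC AA (n : nat) : open (~` [set @Isol AA n]).
Proof.
have fin : finite_set [set m | ~ (~` [set @Isol AA n]) (Isol m)].
  by apply: sub_finite_set (finite_set1 n) => m /contrapT[].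
rewrite psi_openE => -[//|B AAB _|_] /=; first by apply: sub_finite_set fin => m [].
by exists [::] => //; apply: sub_finite_set fin => m [].
Qed.

Lemma Lim_inj AA A B (AAA : AA A) (AAB : AA B) : A = B -> Lim A AAA = Lim B AAB.
Proof. by move=> AB; subst B; rewrite (Prop_irrelevance AAA AAB). Qed.

Section psi_space.
Context (AA : set (set nat)).
Hypothesis ad : forall A B, AA A -> AA B -> A <> B -> finite_set (A `&` B).
Local Notation psi := (psi_compactification AA).

Let clopen_cone A : AA A -> open (@cone AA A) /\ open (~` @cone AA A).
Proof.
move=> AAA; split; first exact: open_cone.
by apply: open_coneC => // B AAB BA; apply: ad => // /esym.
Qed.

Lemma psi_clopen_separation (p q : psi) : p <> q -> exists U : set psi,
  [/\ open U, open (~` U) & (U p /\ ~ U q) \/ (U q /\ ~ U p)].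
Proof.
case: p q => [n|A AAA|] [m|B AAB|] pq //.
all: try by exists [set Isol n]; split; [exact: open_Isol|exact: open_IsolC|left; split=> // /esym].
all: try by exists [set Isol m]; split; [exact: open_Isol|exact: open_IsolC|right].
- have [? ?] := clopen_cone _ AAA; exists (cone A); split=> //; left; split=> //= BA.
  by apply: pq; exact: Lim_inj.
- by have [? ?] := clopen_cone _ AAA; exists (cone A); split=> //; left; split=> // -[].
- by have [? ?] := clopen_cone _ AAB; exists (cone B); split=> //; right; split=> // -[].
Qed.

Lemma psi_hausdorff : hausdorff_space psi.
Proof.
rewrite open_hausdorff => p q /eqP /psi_clopen_separation[U [oU oUC [[Up nUq]|[Uq nUp]]]].
  by exists (U, ~` U); [rewrite !inE|rewrite setICr].
by exists (~` U, U); [rewrite !inE|rewrite setICl].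
Qed.

(** An ultrafilter converging to no isolated point and to no limit point contains the complements of
    all finite sets of isolated points and of all cones, hence every neighborhood of [Infty]. *)
Lemma psi_compact : compact [set: psi].
Proof.
rewrite compact_ultra => F UF _; apply: contrapT => nF.
have {}nF (p : psi) : ~ nbhs p `<=` F by move=> Fp; apply: nF; exists p.
have FIsolC n : F (~` [set Isol n]).
  have [Fn|//] := in_ultra_setVsetC [set Isol n] UF.
  exfalso; apply: (nF (Isol n)) => U /psi_nbhs[Un _].
  by apply: filterS Fn => _ ->.
have FfinC (E : set nat) : finite_set E -> F (~` (Isol @` E)).
  move=> /finite_seqP[s ->]; elim: s => [|n s IHs].
    by apply: filterS filterT => p _ [].
  apply: filterS (filterI (FIsolC n) IHs) => p [pn ps] [m] /=.
  by rewrite inE => /predU1P[-> /esym|ms pm]; [exact: pn | apply: ps; exists m].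
have FconeC A : AA A -> F (~` cone A).
  move=> AAA; have [FA|//] := in_ultra_setVsetC (cone A) UF.
  exfalso; apply: (nF (Lim A AAA)) => U /psi_nbhs[UA /= /FfinC FU].
  apply: filterS (filterI FA FU) => -[n [An nU]|B AAB [BA _]|[[]]].
    by apply: contrapT => nUn; apply: nU; exists n.
  by rewrite (_ : Lim B AAB = Lim A AAA)//; exact: Lim_inj.
apply: (nF Infty) => U /psi_nbhs[UI /= [s sU /FfinC FU]].
have Fs : F [set p | forall A, AA A -> A \in s -> ~ cone A p].
  elim: s {sU FU} => [|B s IHs]; first by apply: filterS filterT.
  have FB : F [set p | AA B -> ~ cone B p].
    have [/FconeC|nB] := pselect (AA B); first by apply: filterS => p ? _.
    by apply: filterS filterT => p _ /nB.
  apply: filterS (filterI IHs FB) => p [ps pB] A AAA.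
  by rewrite inE => /predU1P[AB|/ps]; [subst A; exact: pB | exact].
apply: filterS (filterI Fs FU) => -[n [ns nU]|A AAA [/(_ A AAA) nA _]|//].
  by apply: contrapT => nUn; apply: nU; exists n.
by apply: sU; apply/negP => /nA; exact.
Qed.

Lemma psi_separable : (forall A, AA A -> infinite_set A) -> separable_space psi.
Proof.
(* [Infty] is isolated if finitely many members of [AA] cover a cofinite subset of [nat]. *)
move=> inf; exists (range Isol `|` [set Infty]); split.
  have -> : range Isol `|` [set Infty] =
      range (fun n => if n is m.+1 then Isol m else Infty) :> set psi.
    apply/seteqP; split=> [p [[n _ <-]|->]|_ [[|n] _ <-]].
    - by exists n.+1.
    - by exists 0.
    - by right.
    - by left; exists n.
  exact: sub_countable (card_image_le _ _) _.
apply/seteqP; split=> // p _ U /psi_nbhs[]; case: p => [n Un _|A AAA UA finU|UI _].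
- by exists (Isol n); split=> //; left; exists n.
- have [n [An /= /not_andP nU]] := infinite_setN0 (infinite_setD (inf A AAA) finU).
  exists (Isol n); split; first by left; exists n.
  by case: nU => // /contrapT.
- by exists Infty; split=> //; right.
Qed.
End psi_space.

(** * Convergence along AP-sets and failure of IP-convergence *)

Lemma psi_van_der_Waerden (AA : set (set nat)) :
  (forall (C : set nat) (f : nat -> nat), AP_set C -> finite_to_one_on f C ->
     exists2 A, AA A & exists2 D, AP_set D & D `<=` C `&` f @^-1` A) ->
  van_der_Waerden (psi_compactification AA).
Proof.
move=> AAP x.
have [[p APp]|[C APC [_ f1]]] := AP_constant_or_finite_to_one _ x setT AP_setT.
  exists (setT `&` [set n | x n = p]); split=> //; exists p => U /nbhs_singleton Up.
  by exists 0 => n [_ ->].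
(* [J] consists of the indices with isolated values, so the default 0 is never met on it. *)
pose f n := if x n is Isol m then m else 0.
pose J := [set n | x n = Isol (f n)].
have [APJ|nAPJ] := pselect (AP_set (C `&` J)).
  have f1J : finite_to_one_on f (C `&` J).
    move=> m; have [N NP] := f1 (Isol m); exists N => n [Cn xn] Nn fn.
    by apply: (NP n Cn Nn); rewrite xn fn.
  have [A AAA [D APD DCJ]] := AAP _ _ APJ f1J.
  exists D; split=> //; exists (Lim A AAA) => U /psi_nbhs[_ /= finU].
  have f1D : finite_to_one_on f D by apply: finite_to_one_onS _ _ _ _ _ f1J => n /DCJ[].
  have [N NP] := finite_to_one_on_avoid _ _ _ _ f1D finU.
  exists N => n Dn /(NP n Dn) nU; have [[_ xn] An] := DCJ n Dn.
  by rewrite xn; apply: contrapT => ?; apply: nU.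
(* Off [J] only limit points and [Infty] occur, and a neighborhood of [Infty] misses finitely many
   limit points, each taken finitely often. *)
exists (C `\` J); split; first exact: AP_set_split.
exists Infty => U /psi_nbhs[UI /= [s sU _]].
pose L (A : set nat) : psi_compactification AA :=
  if pselect (AA A) is left AAA then Lim A AAA else Infty.
have finL : finite_set (L @` [set` s]) by exact: finite_image.
have f1J : finite_to_one_on x (C `\` J) by apply: finite_to_one_onS _ _ _ _ _ f1 => n [].
have [N NP] := finite_to_one_on_avoid _ _ _ _ f1J finL.
exists N => n CJn /(NP n CJn); case: CJn => _; rewrite /J /f /=.
case: (x n) => [//|A AAA _ nL|//]; apply: sU; apply/negP => As; apply: nL.
exists A => //; rewrite /L; case: pselect => [AAA'|//].
exact: Lim_inj.
Qed.

Lemma infinite_set_unbounded (B : set nat) : infinite_set B -> forall N, exists2 n, N <= n & B n.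
Proof.
move=> Binf N; apply: contrapT => nB; apply: Binf; apply: sub_finite_set (finite_II N) => n Bn /=.
by rewrite ltnNge; apply/negP => Nn; apply: nB; exists n.
Qed.

Lemma FS_set1 (B : set nat) (b : nat) : B b -> FS B b.
Proof.
move=> Bb; exists [:: b]; split=> //; last by rewrite big_seq1.
by move=> i; rewrite inE => /eqP ->.
Qed.

Lemma FS_set2 (B : set nat) (b b' : nat) : B b -> B b' -> b <> b' -> FS B (b + b').
Proof.
move=> Bb Bb' bb'; exists [:: b; b']; split=> //.
- by rewrite /= inE andbT; exact/eqP.
- by move=> i; rewrite !inE => /predU1P[->|/eqP ->].
- by rewrite big_cons big_seq1.
Qed.

Lemma psi_not_Hindman (AA : set (set nat)) :
  (forall A, AA A -> contains_no_pair_sums A) ->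
  (forall A B, AA A -> AA B -> A <> B -> finite_set (A `&` B)) ->
  (forall (C : set nat) (f : nat -> nat), AP_set C -> finite_to_one_on f C ->
     exists2 A, AA A & exists2 D, AP_set D & D `<=` C `&` f @^-1` A) ->
  ~ Hindman (psi_compactification AA).
Proof.
move=> AAsums ad AAP /(_ Isol)[B [Binf [p IP]]].
have tail_inf n0 : infinite_set (B `\` `I_n0) by exact: infinite_setD.
case: p IP => [m|A AAA|] IP.
- have [|n0 n0P] := IP [set Isol m]; first exact: open_nbhs_nbhs (conj (open_Isol _ _) _).
  have [b mb Bb] := infinite_set_unbounded _ (tail_inf n0) m.+1.
  by have [bm] := n0P b (FS_set1 _ _ Bb); lia.
- have [|n0 n0P] := IP (cone A); first exact: open_nbhs_nbhs (conj (open_cone _ _) _).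
  have [|b [b' [Bb Bb' bb' nA]]] := AAsums A AAA _ (tail_inf n0).
    by move=> b /FS_set1/n0P.
  by apply/nA/(n0P (b + b'))/FS_set2 => //; lia.
(* As [f n] lies in [B] beyond [n], the map [f] is finite-to-one, and some [A] in [AA] has infinite
   intersection with [B]; the complement of its cone is the neighborhood of [Infty] that refutes
   convergence. *)
- have /choice[f fP] : forall n, exists b, n <= b /\ B b.
    by move=> n; have [b] := infinite_set_unbounded _ Binf n; exists b.
  have [m|A AAA [D APD DA]] := AAP setT f AP_setT.
    by exists m.+1 => n _ mn; have [] := fP n; lia.
  have [|n0 n0P] := IP (~` cone A).
    apply: open_nbhs_nbhs; split=> [|[]]; apply: open_coneC => // A' AAA' A'A.
    by apply: ad => // /esym.
  have [n n0n Dn] := AP_set_unbounded _ APD n0.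
  have [nf Bf] := fP n; have [_ Af] := DA n Dn.
  by apply: (n0P (f n)) => //; apply: FS_set1; split=> //= ?; lia.
Qed.

Theorem theorem2p2 : CH ->
  exists T : topologicalType,
    [/\ hausdorff_space T, compact [set: T], separable_space T,
        van_der_Waerden T & ~ Hindman T].
Proof.
move=> /CH_AP_almost_disjoint_family[AA [AA1 ad AAP]].
exists (psi_compactification AA); split.
- exact: psi_hausdorff.
- exact: psi_compact.
- by apply: psi_separable => A /AA1[].
- exact: psi_van_der_Waerden.
- by apply: psi_not_Hindman => // A /AA1[].
Qed.
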